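(* Let $n\ge 2$ and $k\ge 2$ be integers, and let $W_{n,k}$ be the graph defined below. Then the multiset of adjacency eigenvalues of $W_{n,k}$ consists of the eigenvalue $1$ with multiplicity $(k-1)n$, the eigenvalue $-1$ with multiplicity $(k-1)n$, and the $2n$ further values $\tau_j$ and $-\tau_j$ for $j=0,1,\ldots,n-1$ (each listed once for each $j$, so that coinciding values add up their multiplicities), where \[\tau_j=\sqrt{k^2+1+2k\cos\left(\tfrac{2\pi j}{n}\right)}.\]
   Context: The graph $W_{n,k}$ ($n\ge 2$, $k\ge 2$) has $2nk$ vertices $v_{i,j}$ and $w_{i,j}$ for $1\le i\le n$, $1\le j\le k$. Its edges are: for every $1\le i\le n$, every $v_{i,j}$ is adjacent to every $w_{i,l}$ ($1\le j,l\le k$); and additionally, for $1\le i\le n$ and $1\le j\le k$, $w_{i,j}$ is adjacent to $v_{i+1,j}$, where the index $i+1$ is taken modulo $n$ (so $w_{n,j}$ is adjacent to $v_{1,j}$). This is a $(k+1)$-regular bipartite graph. Eigenvalues are those of the adjacency matrix. *)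

(* Defs.v *)
From HB Require Import structures.
From mathcomp Require Import all_boot all_order all_algebra.
From mathcomp Require Import reals trigo.

Set Implicit Arguments.
Unset Strict Implicit.
Unset Printing Implicit Defensive.

Import Order.TTheory GRing.Theory Num.Theory.

Local Open Scope ring_scope.

Definition adjacency_mx (R : nzRingType) (T : finType) (e : rel T) :
    'M[R]_#|T| :=
  \matrix_(x, y) (e (enum_val x) (enum_val y))%:R.

(* The multiset s, represented by a list up to permutation, is the multiset
   of roots of the characteristic polynomial of A, which splits. *)
Definition eigenvalue_multiset (F : fieldType) (m : nat) (A : 'M[F]_m)
    (s : seq F) : Prop :=
  char_poly A = \prod_(x <- s) ('X - x%:P).

(* The multiset is unique: its lists are exactly one permutation class. *)
Lemma eigenvalue_multiset_perm (F : fieldType) (m : nat) (A : 'M[F]_m)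
    (s t : seq F) :
  eigenvalue_multiset A s -> (eigenvalue_multiset A t <-> perm_eq s t).
Proof.
rewrite /eigenvalue_multiset => ->; split=> [|pst].
  exact: prod_XsubC_eq.
exact: perm_big.
Qed.

(* inl (i, j) is v_{i,j} and inr (i, j) is w_{i,j}, with indices from 0. *)
Definition W_vertex (n k : nat) : finType :=
  (('I_n * 'I_k) + ('I_n * 'I_k))%type.

Definition W_vw (n k : nat) (v w : 'I_n * 'I_k) : bool :=
  (v.1 == w.1) || ((v.1 == ordS w.1) && (v.2 == w.2)).

Definition W_adj (n k : nat) : rel (W_vertex n k) :=
  fun x y =>
    match x, y with
    | inl v, inr w => W_vw v w
    | inr w, inl v => W_vw v w
    | _, _ => false
    end.

Lemma W_adj_sym (n k : nat) : symmetric (@W_adj n k).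
Proof. by case=> [v|w] [v'|w']. Qed.

Lemma W_adj_irr (n k : nat) : irreflexive (@W_adj n k).
Proof. by case. Qed.

Definition tau (R : realType) (n k j : nat) : R :=
  Num.sqrt (k%:R ^+ 2 + 1 + 2 * k%:R * cos (2 * pi * j%:R / n%:R)).

(* Main.v *)
(** The bipartite half of the adjacency matrix of [W_{n,k}] is
    [N = I (x) J + S (x) I], with [J] the all-ones matrix of size [k] and [S]
    the cyclic shift of size [n].  Over the complex numbers, [N] and its
    transpose are diagonalised by the characters of [Z_n x Z_k]: at the
    character [(a, b)] their eigenvalues are [k [b = 0] + w^-a] and
    [k [b = 0] + w^a], with [w] a primitive [n]-th root of unity.  The adjacency
    eigenvalues are the two square roots of the product of these two numbers,
    which is [1] for [b <> 0] and [tau_a ^ 2] for [b = 0].  As [k >= 2], none of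
    them vanishes, so the eigenvectors form an explicit basis. *)
Require Import Defs.
From mathcomp Require Import all_boot all_order all_algebra.
From mathcomp Require Import reals trigo.
From mathcomp Require Import complex ring lra.

Set Implicit Arguments.
Unset Strict Implicit.

Import Order.TTheory GRing.Theory Num.Theory.

Local Open Scope ring_scope.

(** * Characteristic polynomials from explicit eigenbases *)

(** The first hypothesis makes [U] invertible, so the second is a similarity between [A] and the
    diagonal matrix of [d]. *)
Lemma char_poly_eigenbasis (F : fieldType) (T : finType) (A U V : T -> T -> F)
    (d : T -> F) :
  (forall x z, \sum_y V x y * U y z = (x == z)%:R) ->
  (forall x z, \sum_y A x y * U y z = U x z * d z) ->
  char_poly (\matrix_(x < #|T|, y < #|T|) A (enum_val x) (enum_val y)) =
  \prod_z ('X - (d z)%:P).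
Proof.
move=> VU AU.
pose mx (f : T -> T -> F) := \matrix_(x < #|T|, y < #|T|) f (enum_val x) (enum_val y).
pose D := diag_mx (\row_(x < #|T|) d (enum_val x)).
have mxM f g x z : (mx f *m mx g) x z =
    \sum_y f (enum_val x) y * g y (enum_val z).
  rewrite !mxE (big_enum_val (fun y => f (enum_val x) y * g y (enum_val z))).
  by apply: eq_bigr => i _; rewrite !mxE.
have VU1 : mx V *m mx U = 1%:M.
  by apply/matrixP=> x z; rewrite mxM VU mxE (inj_eq enum_val_inj).
have AUD : mx A *m mx U = mx U *m D.
  by apply/matrixP=> x z; rewrite mxM AU mul_mx_diag !mxE.
have U0 : \det (map_mx polyC (mx U)) != 0.
  rewrite det_map_mx polyC_eq0; apply/eqP => dU0.
  have := congr1 determinant VU1.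
  by rewrite det_mulmx dU0 mulr0 det1 => /eqP; rewrite eq_sym oner_eq0.
have -> : \prod_z ('X - (d z)%:P) = char_poly D.
  rewrite char_poly_trig ?diag_mx_is_trig //.
  rewrite (big_enum_val (fun z => 'X - (d z)%:P)).
  by apply: eq_bigr => i _; rewrite !mxE eqxx mulr1n.
(* Multiply by [\det U], nonzero over the polynomials, and compare [('X - A) U] with
   [U ('X - D)]. *)
apply: (mulIf U0); rewrite /char_poly -/(mx A) [RHS]mulrC -!det_mulmx.
congr (\det _); rewrite /char_poly_mx mulmxBl mulmxBr -!map_mxM /= AUD.
by rewrite scalar_mxC.
Qed.

(* Above a common eigenvector [P _ c], the adjacency operator acts as the
   2x2 matrix [[0, l c], [l' c, 0]], whose eigenvalues are [s c] and [- s c]. *)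
Lemma char_poly_bipartite (F : numFieldType) (T : finType) (e : rel (T + T))
    (N : T -> T -> bool) (P Q : T -> T -> F) (l l' s : T -> F) :
  (forall x y, e x y = match x, y with
    | inl v, inr w => N v w | inr w, inl v => N v w | _, _ => false end) ->
  (forall c d, \sum_v Q c v * P v d = (c == d)%:R) ->
  (forall v c, \sum_w (N v w)%:R * P w c = P v c * l c) ->
  (forall w c, \sum_v (N v w)%:R * P v c = P w c * l' c) ->
  (forall c, s c != 0) -> (forall c, s c ^+ 2 = l c * l' c) ->
  char_poly (adjacency_mx F e) =
  (\prod_c ('X - (s c)%:P)) * (\prod_c ('X - (- s c)%:P)).
Proof.
move=> eE QP NP NtP s0 s2.
have l0 c : l c != 0.
  by apply: contra_neq (s0 c) => lc0; apply/eqP; rewrite -sqrf_eq0 s2 lc0 mul0r.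
pose sgn (x : T + T) : F := if x is inl _ then 1 else -1.
pose idx (x : T + T) : T := match x with inl c | inr c => c end.
(* The column at [inl c] or [inr c] is for the eigenvalue [s c] or [- s c]: the vector
   [(l c / s c, 1)] or [(- l c / s c, 1)] of the 2x2 block, spread along [P _ c]. [V] is the dual
   basis. *)
pose U (y x : T + T) : F := match y with
  | inl v => sgn x * (l (idx x) / s (idx x)) * P v (idx x)
  | inr w => P w (idx x) end.
pose V (x y : T + T) : F := match y with
  | inl v => 2^-1 * sgn x * (s (idx x) / l (idx x)) * Q (idx x) v
  | inr w => 2^-1 * Q (idx x) w end.
pose d (x : T + T) : F := sgn x * s (idx x).
have sgn2 x : sgn x * sgn x = 1 by case: x => ? /=; rewrite ?mulrNN mulr1.
rewrite /adjacency_mx (@char_poly_eigenbasis _ _ (fun x y => (e x y)%:R) U V d).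
- rewrite big_sumType /d /=; congr (_ * _); apply: eq_bigr => c _.
    by rewrite mul1r.
  by rewrite mulN1r.
- move=> x z; rewrite big_sumType /=.
  transitivity (2^-1 * (sgn x * sgn z * (s (idx x) / l (idx x)) *
      (l (idx z) / s (idx z)) + 1) * (idx x == idx z)%:R).
    rewrite -QP mulrDr mulrDl !mulr_sumr; congr (_ + _).
      by apply: eq_bigr => v _; ring.
    by apply: eq_bigr => v _; ring.
  have [eqi|nei] := eqVneq (idx x) (idx z); last first.
    by rewrite mulr0; case: eqP => // xz; rewrite xz eqxx in nei.
  have -> : sgn x * sgn z * (s (idx x) / l (idx x)) * (l (idx z) / s (idx z)) =
      sgn x * sgn z by rewrite eqi; field; rewrite l0 s0.
  (* [2^-1 * (sgn x * sgn z + 1)] is 1 for equal signs and 0 for opposite ones. *)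
  move: eqi; case: x => c; case: z => c' /= eqi; rewrite ?eqi ?eqxx /=; by field.
- move=> x z; rewrite big_sumType /= /d.
  case: x => v.
    rewrite big1 => [|w _]; last by rewrite eE mul0r.
    rewrite add0r /=; under eq_bigr do rewrite eE.
    by rewrite NP; transitivity ((sgn z * sgn z) * P v (idx z) * l (idx z));
      [rewrite sgn2 mul1r | field].
  rewrite addrC big1 => [|w _]; last by rewrite eE mul0r.
  rewrite add0r /=.
  transitivity (sgn z * (l (idx z) / s (idx z)) *
      \sum_v0 (N v0 v)%:R * P v0 (idx z)).
    by rewrite mulr_sumr; apply: eq_bigr => v0 _; rewrite eE; ring.
  rewrite NtP; transitivity (P v (idx z) * (sgn z * (l (idx z) * l' (idx z)) / s (idx z))).
    by ring.
  by rewrite -s2; field.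
Qed.

(** * Characters of the cyclic groups and the half-adjacency of [W_{n,k}] *)

(** This is a geometric sum whose ratio is an [n]-th root of unity, equal to 1 only if [a = b]. *)
Lemma sum_prim_root_expr (F : fieldType) (n : nat) (z : F)
    (zP : n.-primitive_root z) (a b : 'I_n) :
  \sum_(i < n) z ^- (a * i) * z ^+ (i * b) = n%:R * (a == b)%:R.
Proof.
have z0 : z != 0 by rewrite (prim_root_eq0 zP) -lt0n (prim_order_gt0 zP).
transitivity (\sum_(i < n) (z ^+ b / z ^+ a) ^+ i).
  by apply: eq_bigr => i _; rewrite exprMn exprVn -!exprM mulrC [(i * b)%N]mulnC.
have [->|neq] := eqVneq a b.
  rewrite divff ?expf_neq0 //; under eq_bigr do rewrite expr1n.
  by rewrite sumr_const card_ord mulr1.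
have w1 : z ^+ b / z ^+ a - 1 != 0.
  rewrite subr_eq0; apply: contra_neq neq => /divr1_eq /eqP.
  by rewrite (eq_prim_root_expr zP) eq_sym => /eqP; rewrite !modn_small // => /val_inj.
apply: (mulfI w1); rewrite -subrX1 exprMn exprVn -!exprM !(mulnC _ n) !exprM.
by rewrite (prim_expr_order zP) !expr1n divr1 subrr !mulr0.
Qed.

Lemma sum_prim_root_expr0 (F : fieldType) (n : nat) (z : F)
    (zP : n.-primitive_root z) (b : 'I_n) :
  \sum_(i < n) z ^+ (i * b) = n%:R * (b == 0%N :> nat)%:R.
Proof.
case: n zP b => [_ []//|n] zP b; rewrite -[0%N]/(nat_of_ord (@ord0 n)) eq_sym.
rewrite -[_ == _]/(ord0 == b) -(sum_prim_root_expr zP).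
by apply: eq_bigr => i _; rewrite mul0n expr0 invr1 mul1r.
Qed.

Lemma W_vw_character (F : fieldType) (n k : nat) (z y : F) :
  (1 < n)%N -> n.-primitive_root z -> k.-primitive_root y ->
  let P (v c : 'I_n * 'I_k) : F := z ^+ (v.1 * c.1) * y ^+ (v.2 * c.2) in
  let l (t : F) (c : 'I_n * 'I_k) : F :=
    k%:R * (c.2 == 0%N :> nat)%:R + t ^+ c.1 in
  (forall v c, \sum_w (W_vw v w)%:R * P w c = P v c * l z^-1 c) /\
  (forall w c, \sum_v (W_vw v w)%:R * P v c = P w c * l z c).
Proof.
move=> n1 zP yP P l.
have z0 : z != 0 by rewrite (prim_root_eq0 zP) -lt0n ltnW.
have ordSz (i a : 'I_n) : z ^+ (ordS i * a) = z ^+ (i * a) * z ^+ a.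
  by rewrite exprM /= (prim_expr_mod zP) -exprM mulSn exprD mulrC.
(* With [n >= 2] the shift has no fixed point, so the two disjuncts of [W_vw] exclude each other and
   its indicator is a sum. *)
have ordS_neq (i : 'I_n) : ordS i != i.
  have n_gt0 : (0 < n)%N := ltnW n1.
  apply/eqP => /(congr1 val) /= eqi; have := congr1 (fun m => m == i :> nat) eqi.
  have [lt_i|] := ltnP i.+1 n; first by rewrite modn_small // eqxx gtn_eqF.
  move=> le_i; have i1 : i.+1 = n by apply/eqP; rewrite eqn_leq le_i ltn_ord.
  by move: eqi; rewrite i1 modnn => i0; move: i1 n1; rewrite -i0 => <-.
have vwE (v w : 'I_n * 'I_k) : (W_vw v w)%:R =
    (v.1 == w.1)%:R + ((v.1 == ordS w.1) && (v.2 == w.2))%:R :> F.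
  rewrite /W_vw; case: eqVneq => [->|_] /=; last by rewrite add0r.
  by rewrite eq_sym (negPf (ordS_neq _)) addr0.
have y1 (b j : 'I_k) : b = 0%N :> nat -> y ^+ (j * b) = 1.
  by move=> ->; rewrite muln0.
have sum_same i c : \sum_(w : 'I_n * 'I_k) (i == w.1)%:R * P w c =
    z ^+ (i * c.1) * (k%:R * (c.2 == 0%N :> nat)%:R).
  rewrite -(sum_prim_root_expr0 yP) mulr_sumr.
  rewrite -(pair_bigA _ (fun a b => (i == a)%:R * P (a, b) c)) /=.
  rewrite (bigD1 i) //= [X in _ + X]big1 ?addr0 => [|a ai].
    by apply: eq_bigr => b _; rewrite eqxx mul1r.
  by rewrite big1 // => b _; rewrite eq_sym (negPf ai) mul0r.
(* The factor in [y] can be inserted freely: it is 1 when [c.2] is 0, and otherwise both sides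
   vanish. *)
have PJ i (v c : 'I_n * 'I_k) :
    z ^+ (i * c.1) * (k%:R * (c.2 == 0%N :> nat)%:R) =
    z ^+ (i * c.1) * y ^+ (v.2 * c.2) * (k%:R * (c.2 == 0%N :> nat)%:R).
  by case: eqP => [/y1->|_]; rewrite ?mulr0 ?mulr1.
split=> [v|w] c; rewrite /l mulrDr; under eq_bigr do rewrite vwE mulrDl.
  rewrite big_split sum_same (PJ _ v) /=; congr (_ + _).
  (* The only shift neighbour of [v] lies one step back, whence [z^-1]. *)
  rewrite (bigD1 (ord_pred v.1, v.2)) //= big1 ?addr0 => [|[a b] ab].
    rewrite ord_predK !eqxx mul1r exprVn /P /= -[in RHS](ord_predK v.1) ordSz.
    by rewrite [RHS]mulrAC mulfK ?expf_neq0.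
  case: andP => [[/= /eqP va /eqP vb]|]; last by rewrite mul0r.
  by rewrite va vb ordSK eqxx in ab.
under eq_bigr do rewrite [_ == w.1]eq_sym.
rewrite big_split sum_same (PJ _ w) /=; congr (_ + _).
rewrite (bigD1 (ordS w.1, w.2)) //= big1 ?addr0 => [|[a b] ab].
  by rewrite !eqxx mul1r /P ordSz /=; ring.
case: andP => [[/= /eqP va /eqP vb]|]; last by rewrite mul0r.
by rewrite va vb eqxx in ab.
Qed.

Lemma char_poly_W (F : numFieldType) (n k : nat) (z y : F)
    (s : 'I_n * 'I_k -> F) :
  (1 < n)%N -> n.-primitive_root z -> k.-primitive_root y ->
  (forall c, s c != 0) ->
  (forall c, s c ^+ 2 = (k%:R * (c.2 == 0%N :> nat)%:R + z^-1 ^+ c.1) *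
                        (k%:R * (c.2 == 0%N :> nat)%:R + z ^+ c.1)) ->
  char_poly (adjacency_mx F (@W_adj n k)) =
  (\prod_c ('X - (s c)%:P)) * (\prod_c ('X - (- s c)%:P)).
Proof.
move=> n1 zP yP s0 s2; have [NP NtP] := W_vw_character n1 zP yP.
have n0 : n%:R != 0 :> F by rewrite pnatr_eq0 -lt0n ltnW.
have k0 : k%:R != 0 :> F by rewrite pnatr_eq0 -lt0n (prim_order_gt0 yP).
(* Inverse characters over [n * k]: dual to [P] by orthogonality. *)
pose Q (c v : 'I_n * 'I_k) : F :=
  n%:R^-1 * z ^- (c.1 * v.1) * (k%:R^-1 * y ^- (c.2 * v.2)).
apply: (char_poly_bipartite (N := @W_vw n k) (Q := Q) _ _ NP NtP s0 s2) => //.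
move=> [a b] [a' b']; rewrite /Q /=.
rewrite -(pair_bigA _ (fun (i : 'I_n) (j : 'I_k) => n%:R^-1 * z ^- (a * i) * (k%:R^-1 *
  y ^- (b * j)) * (z ^+ (i * a') * y ^+ (j * b')))) /=.
transitivity ((n%:R^-1 * \sum_(i < n) z ^- (a * i) * z ^+ (i * a')) *
              (k%:R^-1 * \sum_(j < k) y ^- (b * j) * y ^+ (j * b'))).
  rewrite mulr_sumr [X in _ * X]mulr_sumr big_distrlr /=.
  by apply: eq_bigr => i _; apply: eq_bigr => j _; ring.
rewrite (sum_prim_root_expr zP) (sum_prim_root_expr yP) !mulKf //.
by rewrite xpair_eqE -natrM mulnb.
Qed.

(** * Complex roots of unity from trigonometry *)

Definition cis (R : realType) (x : R) : R[i] := Complex (cos x) (sin x).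

Lemma cisX (R : realType) (x : R) (m : nat) : cis x ^+ m = cis (x * m%:R).
Proof.
elim: m => [|m IH]; first by rewrite mulr0 /cis cos0 sin0.
rewrite exprS IH /cis -natr1 mulrDr mulr1 addrC cosD sinD.
by apply/eqP; rewrite eq_complex /= !eqxx /= addrC.
Qed.

Lemma cisV (R : realType) (x : R) : (cis x)^-1 = cis (- x).
Proof.
have cc : cis (- x) * cis x = 1.
  apply/eqP; rewrite eq_complex /= cosN sinN !mulNr opprK -!expr2 cos2Dsin2.
  by rewrite mulrC subrr !eqxx.
have c0 : cis x != 0 by apply: contra_eq_neq cc => ->; rewrite mulr0 eq_sym oner_eq0.
by rewrite -[LHS]mul1r -cc mulfK.
Qed.

(** The real part is [1 - 2 sin(x/2)^2], and [sin] is positive on the open interval from 0 to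
    [pi]. *)
Lemma cis_neq1 (R : realType) (x : R) : 0 < x < 2 * pi -> cis x != 1.
Proof.
case/andP=> x0 x2; rewrite eq_complex /= negb_and; apply/orP; left.
have -> : x = (x / 2) *+ 2 by rewrite -mulr_natr divfK ?pnatr_eq0.
have : 0 < sin (x / 2) by apply: sin_gt0_pi; apply/andP; split; lra.
move=> s0; rewrite cos_mulr2n cos2sin2; apply/eqP => e.
have : 0 < sin (x / 2) ^+ 2 by rewrite exprn_gt0.
by move: e; rewrite -mulr_natr => e; lra.
Qed.

Lemma cis_prim_root (R : realType) (n : nat) : (0 < n)%N ->
  n.-primitive_root (cis (2 * pi / n%:R : R)).
Proof.
move=> n0; have nR : 0 < n%:R :> R by rewrite ltr0n.
apply/andP; split=> //; apply/forallP => i; rewrite unity_rootE cisX.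
apply/eqP; have [->|ni] := eqVneq i.+1 n.
  rewrite divfK ?(gt_eqF nR) // mulrC mulr_natr /cis cos2pi sin2pi.
  by apply/eqP.
apply/negbTE/cis_neq1; have pi0 := pi_gt0 R.
rewrite -mulrA; apply/andP; split.
  by rewrite !mulr_gt0 ?invr_gt0.
rewrite gtr_pMr ?mulr_gt0 // mulrC ltr_pdivrMr // mul1r ltr_nat.
by rewrite ltn_neqAle ni ltn_ord.
Qed.

(** * The values [tau] and the spectrum *)

(** As [cos] is at least -1, the radicand is at least [(k - 1)^2], which is positive. *)
Lemma tau_gt0 (R : realType) (n k j : nat) : (2 <= k)%N -> 0 < tau R n k j.
Proof.
move=> k2; rewrite sqrtr_gt0; have : 2 <= k%:R :> R by rewrite ler_nat.
set c := cos _; have : -1 <= c by apply: cos_geN1.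
by move=> c1 k2'; nra.
Qed.

Lemma tau_sqr (R : realType) (n k j : nat) : (2 <= k)%N ->
  tau R n k j ^+ 2 =
  k%:R ^+ 2 + 1 + 2 * k%:R * cos (2 * pi / n%:R * j%:R).
Proof.
move=> k2; rewrite sqr_sqrtr; first by rewrite [2 * pi / _ * _]mulrAC.
by apply: ltW; rewrite -sqrtr_gt0; exact: tau_gt0.
Qed.

Theorem theorem5 (R : realType) (n k : nat)
    (hn : (2 <= n)%N) (hk : (2 <= k)%N) :
  eigenvalue_multiset (adjacency_mx R (@W_adj n k))
    (nseq ((k - 1) * n) (1 : R) ++ nseq ((k - 1) * n) (-1 : R) ++
     [seq tau R n k j | j <- iota 0 n] ++ [seq - tau R n k j | j <- iota 0 n]).
Proof.
pose s (c : 'I_n * 'I_k) : R := if c.2 == 0%N :> nat then tau R n k c.1 else 1.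
have k0 : (0 < k)%N := ltnW hk.
have zP := cis_prim_root R (ltnW hn).
have yP := cis_prim_root R k0.
have prod_s (g : R -> {poly R}) : \prod_c g (s c) =
    g 1 ^+ ((k - 1) * n) * \prod_(j <- iota 0 n) g (tau R n k j).
  rewrite -(pair_bigA _ (fun a b => g (s (a, b)))) /=.
  rewrite -[n in iota 0 n]subn0 big_mkord mulnC mulrC.
  (* Writing [k] as a successor splits off [b = 0], which gives [tau]; the other [k - 1] indices
     give 1. *)
  case: k k0 @s {hk yP} => // k' _ s; rewrite subn1 /= mulnC exprM.
  under eq_bigr do rewrite big_ord_recl /s /= prodr_const card_ord.
  by rewrite big_split prodr_const card_ord.
rewrite /eigenvalue_multiset !big_cat !big_map !big_nseq !iter_mulr_1 /=.
have -> : char_poly (adjacency_mx R (@W_adj n k)) =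
    (\prod_c ('X - (s c)%:P)) * (\prod_c ('X - (- s c)%:P)).
  (* The eigenvalues are real but the characters are not, so the polynomials are compared over
     [R[i]]. *)
  apply: (map_poly_inj (real_complex R : {rmorphism R -> R[i]})).
  rewrite map_char_poly rmorphM !rmorph_prod /=.
  under eq_bigr do rewrite rmorphB /= map_polyX map_polyC.
  under [X in _ = _ * X]eq_bigr do rewrite rmorphB /= map_polyX map_polyC /= rmorphN.
  have -> : (adjacency_mx R (@W_adj n k) ^ real_complex R)%sesqui =
      adjacency_mx R[i] (@W_adj n k).
    by apply/matrixP=> x y; rewrite !mxE rmorph_nat.
  apply: (char_poly_W hn zP yP) => -[a b] /=.
    rewrite fmorph_eq0 /s /=; case: ifP => _; last exact: oner_neq0.
    by rewrite gt_eqF ?tau_gt0.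
  rewrite -rmorphXn cisV !cisX /s /=; case: ifP => _ /=; last first.
    (* For [b] nonzero only the shift contributes, and [z^-a * z^a = 1]. *)
    rewrite mulr0 !add0r expr1n mulNr -cisV mulVf //.
    by rewrite -cisX expf_neq0 // (prim_root_eq0 zP) -lt0n ltnW.
  rewrite tau_sqr // mulr1 mulNr /cis cosN sinN -[k%:R in RHS](rmorph_nat (real_complex R)).
  set t := _ / _ * _; have := cos2Dsin2 t => cs.
  apply/eqP; rewrite eq_complex /=; apply/andP; split; apply/eqP; last by ring.
  (* The real part is [|k + cis t|^2]; the 1 in the radicand becomes [cos t ^+ 2 + sin t ^+ 2]. *)
  by rewrite -[X in _ + X + _]cs; ring.
rewrite (prod_s (fun x => 'X - x%:P)) (prod_s (fun x => 'X - (- x)%:P)).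
by rewrite mulrACA -mulrA.
Qed.
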